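(* Let $\mathcal{M}=(X,\leq,S,V)$ and $\mathcal{M}'=(X',\leq',S',V')$ be strictly condensed $\mathsf{Int}^{\partial}_{\Diamond}$-models such that $\leq$ and $\leq'$ are pre-image-compact and $S$ and $S'$ are image-compact. Then for all $x\in X$ and $x'\in X'$, $x$ and $x'$ are $\mathsf{Int}^{\partial}_{\Diamond}$-bisimilar if and only if they satisfy exactly the same $\mathsf{Int}^{\partial}_{\Diamond}$-formulae.
   Context: For relations $Z,Z'$ write $x(Z\circ Z')y$ iff there is $u$ with $xZu$ and $uZ'y$; $Z[x]=\{y\mid xZy\}$, $Z^{-1}[x]=\{y\mid yZx\}$. $\mathsf{Int}^{\partial}_\Diamond$ is the language $\phi::=\top\mid\bot\mid p\mid\phi\wedge\phi\mid\phi\vee\phi\mid\phi\,{-\!\!<}\,\phi\mid\Diamond\phi$ over a set $\mathrm{Prop}$. An $\mathsf{Int}^{\partial}_{\Diamond}$-model is $(X,\leq,S,V)$ with $\leq$ a preorder, $S\subseteq X\times X$ satisfying $({\geq}\circ S)\subseteq(S\circ{\geq})$, and $V$ mapping variables to upsets of $(X,\leq)$; strictly condensed means $({\geq}\circ S\circ{\geq})\subseteq S$. Truth: $x\Vdash p$ iff $x\in V(p)$; $\top,\bot,\wedge,\vee$ as usual; $x\Vdash\phi\,{-\!\!<}\,\psi$ iff some $y\leq x$ has $y\Vdash\phi$, $y\not\Vdash\psi$; $x\Vdash\Diamond\phi$ iff some $y$ with $xSy$ has $y\Vdash\phi$. For upsets: $a\ominus b=\{x\mid\exists y\leq x,\ y\in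 a,\ y\notin b\}$, $\Diamond_S a=\{x\mid \exists y\in a,\ xSy\}$. A relation $Z\in\{\leq,S\}$ is image-compact (resp. pre-image-compact) if there is a collection $A$ of upsets containing $\emptyset,X$ and all $V(p)$, closed under finite unions, finite intersections, $\ominus$ and $\Diamond_S$, such that $Z[x]$ (resp. $Z^{-1}[x]$) is compact for every $x$ in the topology generated by the subbase $A\cup\{X\setminus a\mid a\in A\}$. An $\mathsf{Int}^\partial_\Diamond$-bisimulation is $B\subseteq X\times X'$ such that for all $(x,x')\in B$: $x\in V(p)$ iff $x'\in V'(p)$; if $y\leq x$ there is $y'\leq'x'$ with $yBy'$; if $y'\leq'x'$ there is $y\leq x$ with $yBy'$; if $xSy$ there is $y'$ with $x'S'y'$, $yBy'$; if $x'S'y'$ there is $y$ with $xSy$, $yBy'$. States are bisimilar if some bisimulation contains the pair. *)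

(* Defs.v *)
From HB Require Import structures.
From mathcomp Require Import all_boot all_order.
From mathcomp Require Import all_classical.
From mathcomp Require Import topology.
Set Implicit Arguments.
Unset Strict Implicit.
Unset Printing Implicit Defensive.
Local Open Scope classical_set_scope.

Section Relations.
Variable X : Type.
Implicit Types Z W : X -> X -> Prop.

Definition rcomp Z W : X -> X -> Prop := fun x y => exists u, Z x u /\ W u y.
Definition rconv Z : X -> X -> Prop := fun x y => Z y x.
Definition rsub Z W : Prop := forall x y, Z x y -> W x y.
Definition rimage Z (x : X) : set X := [set y | Z x y].
Definition rpreimage Z (x : X) : set X := [set y | Z y x].

Definition is_upset Z (a : set X) : Prop := forall x y, Z x y -> a x -> a y.

End Relations.

Inductive formula (P : Type) : Type :=
| FTop
| FBot
| FVar of P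
| FAnd of formula P & formula P
| FOr of formula P & formula P
| FSub of formula P & formula P (* FSub phi psi is phi -< psi *)
| FDia of formula P.

Record model (P : Type) := Model {
  world :> Type;
  mle : world -> world -> Prop;
  mS : world -> world -> Prop;
  mV : P -> set world;
  mle_refl : forall x, mle x x;
  mle_trans : forall x y z, mle x y -> mle y z -> mle x z;
  mS_ge : rsub (rcomp (rconv mle) mS) (rcomp mS (rconv mle));
  mV_upset : forall p, is_upset mle (mV p)
}.

Definition strictly_condensed P (M : model P) : Prop :=
  rsub (rcomp (rcomp (rconv (@mle P M)) (@mS P M)) (rconv (@mle P M)))
       (@mS P M).

Fixpoint sat P (M : model P) (x : M) (phi : formula P) {struct phi} : Prop :=
  match phi with
  | FTop => True
  | FBot => False
  | FVar p => mV p x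
  | FAnd f g => sat x f /\ sat x g
  | FOr f g => sat x f \/ sat x g
  | FSub f g => exists y : M, [/\ mle y x, sat y f & ~ sat y g]
  | FDia f => exists y : M, mS x y /\ sat y f
  end.

Definition usub P (M : model P) (a b : set M) : set M :=
  [set x | exists y, [/\ mle y x, a y & ~ b y]].

Definition udia P (M : model P) (a : set M) : set M :=
  [set x | exists y, a y /\ mS x y].

(* Closure under empty unions and intersections is adm_set0 and adm_setT. *)
Record admissible P (M : model P) (A : set (set M)) : Prop := Admissible {
  adm_upset : forall a, A a -> is_upset (@mle P M) a;
  adm_set0 : A set0;
  adm_setT : A setT;
  adm_val : forall p, A (mV p);
  adm_setU : forall a b, A a -> A b -> A (a `|` b);
  adm_setI : forall a b, A a -> A b -> A (a `&` b);
  adm_usub : forall a b, A a -> A b -> A (usub a b);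
  adm_udia : forall a, A a -> A (udia a)
}.

(* An alias of X carrying the topology generated by the subbase
   A `|` [set ~` a | a in A]. *)
Definition subbase_space (X : Type) (A : set (set X)) : Type := X.

Section SubbaseTopology.
Variables (X : Type) (A : set (set X)).

HB.instance Definition _ := gen_eqMixin (subbase_space A).
HB.instance Definition _ := gen_choiceMixin (subbase_space A).
HB.instance Definition _ := @isSubBaseTopological.Build (subbase_space A)
  (set X) (A `|` [set ~` a | a in A]) id.

End SubbaseTopology.

Definition image_compact P (M : model P) (Z : M -> M -> Prop) : Prop :=
  exists A : set (set M),
    admissible A /\ forall x : M, @compact (subbase_space A) (rimage Z x).

Definition preimage_compact P (M : model P) (Z : M -> M -> Prop) : Prop :=
  exists A : set (set M),
    admissible A /\ forall x : M, @compact (subbase_space A) (rpreimage Z x).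

Record bisimulation P (M M' : model P) (B : M -> M' -> Prop) : Prop :=
  Bisimulation {
  bis_val : forall x x', B x x' -> forall p, mV p x <-> mV p x';
  bis_le_forth : forall x x', B x x' -> forall y, mle y x ->
    exists y', mle y' x' /\ B y y';
  bis_le_back : forall x x', B x x' -> forall y', mle y' x' ->
    exists y, mle y x /\ B y y';
  bis_S_forth : forall x x', B x x' -> forall y, mS x y ->
    exists y', mS x' y' /\ B y y';
  bis_S_back : forall x x', B x x' -> forall y', mS x' y' ->
    exists y, mS x y /\ B y y'
}.

Definition bisimilar P (M M' : model P) (x : M) (x' : M') : Prop :=
  exists B : M -> M' -> Prop, bisimulation B /\ B x x'.

(* Main.v *)
From mathcomp Require Import all_boot all_classical topology.
Require Import Defs.
Set Implicit Arguments.
Unset Strict Implicit.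
Unset Printing Implicit Defensive.
Local Open Scope classical_set_scope.

(** Logical equivalence is itself a bisimulation. If [y <= x] and [x] is
equivalent to [x'], then [f -< g] holds at [x] whenever [f] holds and [g] fails
at [y]; transferring this to [x'] and using compactness of the downset of [x']
yields a single [y' <= x'] with the same theory as [y]. If [x S y], the
formulas [<> f] give by compactness only some [z'] with [x' S' z'] satisfying
at least the theory of [y]; the previous argument below [z'] then provides
[y' <= z'] with exactly that theory, and [x' S' y'] by strict condensation. *)

Definition modally_equivalent P (M M' : model P) (x : M) (x' : M') : Prop :=
  forall phi, sat x phi <-> sat x' phi.

Lemma modally_equivalent_sym P (M M' : model P) (x : M) (x' : M') :
  modally_equivalent x x' -> modally_equivalent x' x.
Proof. by move=> e phi; split=> /e. Qed.

Lemma bisimulation_modally_equivalent P (M M' : model P) (B : M -> M' -> Prop) :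
  bisimulation B -> forall x x', B x x' -> modally_equivalent x x'.
Proof.
move=> bB x x' Bxx' phi.
elim: phi x x' Bxx' => [||p|f IHf g IHg|f IHf g IHg|f IHf g IHg|f IHf] x x' Bxx' //=.
- exact: bis_val bB _ _ Bxx' p.
- by rewrite (IHf _ _ Bxx') (IHg _ _ Bxx').
- by rewrite (IHf _ _ Bxx') (IHg _ _ Bxx').
- split=> -[y [le_yx yf yg]].
    have [y' [le_y'x' Byy']] := bis_le_forth bB Bxx' le_yx.
    by exists y'; split=> //; [apply/(IHf _ _ Byy') | move/(IHg _ _ Byy')].
  have [z [le_zx Bzy]] := bis_le_back bB Bxx' le_yx.
  by exists z; split=> //; [apply/(IHf _ _ Bzy) | move/(IHg _ _ Bzy)].
- split=> -[y [Sxy yf]].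
    have [y' [Sxy' Byy']] := bis_S_forth bB Bxx' Sxy.
    by exists y'; split=> //; apply/(IHf _ _ Byy').
  have [z [Sxz Bzy]] := bis_S_back bB Bxx' Sxy.
  by exists z; split=> //; apply/(IHf _ _ Bzy).
Qed.

Definition truth_set P (M : model P) (phi : formula P) : set M :=
  [set x | sat x phi].
Arguments truth_set {P} M phi.

(** Truth sets thus lie in every admissible family, so they are clopen in its topology whichever
    family witnesses compactness. *)
Lemma admissible_truth_set P (M : model P) (A : set (set M)) phi :
  admissible A -> A (truth_set M phi).
Proof.
move=> admA.
elim: phi => [||p|f IHf g IHg|f IHf g IHg|f IHf g IHg|f IHf].
- exact: adm_setT.
- exact: adm_set0.
- exact: adm_val.
- exact: adm_setI.
- exact: adm_setU.
- exact: adm_usub.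
- suff -> : truth_set M (FDia f) = udia (truth_set M f) by exact: adm_udia.
  by apply/seteqP; split=> x [y [? ?]]; exists y.
Qed.

Lemma subbase_space_open (X : Type) (A : set (set X)) (U : set X) :
  (A `|` [set ~` a | a in A]) U -> @open (subbase_space A) U.
Proof.
move=> AU; exists [set U]; last by rewrite bigcup_set1.
by move=> _ ->; apply: (finI_from1 id).
Qed.

(** The sets of points of [K] satisfying [f] and refuting [g], for [f] in [G] and [g] in [D], form a
    filter base: conjunctions in [G] and disjunctions in [D] handle intersections, and the last
    hypothesis makes it proper. A cluster point in [K] is the desired [z], because truth sets are
    clopen. *)
Lemma compact_saturation P (M : model P) (A : set (set M)) (K : set M)
    (G D : set (formula P)) :
  admissible A -> @compact (subbase_space A) K ->
  G (FTop P) -> (forall f g, G f -> G g -> G (FAnd f g)) ->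
  D (FBot P) -> (forall f g, D f -> D g -> D (FOr f g)) ->
  (forall f g, G f -> D g -> exists z, [/\ K z, sat z f & ~ sat z g]) ->
  exists z, [/\ K z, forall f, G f -> sat z f & forall g, D g -> ~ sat z g].
Proof.
move=> admA cK GT GI D0 DU GD.
pose base (fg : formula P * formula P) : set (subbase_space A) :=
  [set z | [/\ K z, sat (z : M) fg.1 & ~ sat (z : M) fg.2]].
pose F := filter_from [set fg | G fg.1 /\ D fg.2] base.
have FF : ProperFilter F.
  apply: filter_from_proper; last first.
    by move=> [f g] /= [Gf Dg]; have [z ?] := GD _ _ Gf Dg; exists z.
  apply: filter_from_filter; first by exists (FTop P, FBot P).
  move=> [f1 g1] [f2 g2] /= [Gf1 Dg1] [Gf2 Dg2].
  exists (FAnd f1 f2, FOr g1 g2); first by split; [exact: GI | exact: DU].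
  by move=> z /= [Kz [zf1 zf2] /not_orP[zg1 zg2]].
have FK : F K by exists (FTop P, FBot P) => // z [].
have [z [Kz clz]] := cK F FF FK.
(* A subbasic open set around the cluster point meets every member of [F], so its complement is not
   in [F]. *)
have avoid U : (A `|` [set ~` a | a in A]) U -> U z -> ~ F (~` U).
  move=> AU Uz FU.
  have [|w []] := clz (~` U) U FU; last by [].
  by apply: open_nbhs_nbhs; split=> //; exact: subbase_space_open.
exists z; split=> // [f Gf|g Dg].
  apply: contrapT => zf.
  apply: (avoid (~` truth_set M f)) => //.
    by right; exists (truth_set M f) => //; exact: admissible_truth_set.
  by rewrite setCK; exists (f, FBot P) => // w [].
move=> zg; apply: (avoid (truth_set M g)) => //.
  by left; exact: admissible_truth_set.
by exists (FTop P, g) => // w [].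
Qed.

(** Take for [G] the theory of [y] and for [D] its complement. If [f] holds and [g] fails at [y],
    reflexivity makes [f -< g] true at [y], hence at [x'], which supplies the required point below
    [x']. *)
Lemma preimage_compact_theory P (M M' : model P) (y : M) (x' : M') :
  preimage_compact (@mle P M') ->
  (forall f, sat y f -> sat x' f) ->
  exists y', mle y' x' /\ modally_equivalent y y'.
Proof.
move=> [A [admA cA]] sub.
have [||||f g yf yg|y' [le_y'x' y'G y'D]] := @compact_saturation _ _ _ _
  [set f | sat y f] [set f | ~ sat y f] admA (cA x').
- by [].
- by [].
- by move=> [].
- by move=> f g yf yg [].
- by apply: (sub (FSub f g)); exists y; split=> //; exact: mle_refl.
exists y'; split=> // f; split; first exact: y'G.
by move=> y'f; apply: contrapT => /y'D.
Qed.

(** Diamonds transfer only positive information, so [D] consists of the formulas false throughout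
    [M'] and imposes no constraint on [z']. *)
Lemma image_compact_theory P (M M' : model P) (x y : M) (x' : M') :
  image_compact (@mS P M') -> modally_equivalent x x' -> mS x y ->
  exists z', mS x' z' /\ forall f, sat y f -> sat z' f.
Proof.
move=> [A [admA cA]] e Sxy.
have [||||f g yf Dg|z' [Sx'z' z'G _]] := @compact_saturation _ _ _ _
  [set f | sat y f] [set f | forall z : M', ~ sat z f] admA (cA x').
- by [].
- by [].
- by move=> z [].
- by move=> f g Df Dg z [/Df|/Dg].
- have /e[z' [Sx'z' z'f]] : sat x (FDia f) by exists y.
  by exists z'; split=> //; exact: Dg.
by exists z'.
Qed.

Lemma sat_mle P (M : model P) (x y : M) f : mle x y -> sat x f -> sat y f.
Proof.
elim: f x y => [||p|f IHf g IHg|f IHf g IHg|f IHf g IHg|f IHf] x y le_xy //=.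
- exact: mV_upset le_xy.
- by move=> [xf xg]; split; [exact: IHf xf | exact: IHg xg].
- by move=> [xf|xg]; [left; exact: IHf xf | right; exact: IHg xg].
- by move=> [z [le_zx zf zg]]; exists z; split=> //; exact: mle_trans le_xy.
- move=> [z [Sxz zf]].
  (* The inclusion of [>= ; S] in [S ; >=] turns [y >= x S z] into [y S u >= z]. *)
  have [u [Syu le_zu]] : rcomp (@mS P M) (rconv (@mle P M)) y z.
    by apply: mS_ge; exists x.
  by exists u; split=> //; exact: IHf zf.
Qed.

Lemma modally_equivalent_le_forth P (M M' : model P) (x y : M) (x' : M') :
  preimage_compact (@mle P M') -> modally_equivalent x x' -> mle y x ->
  exists y', mle y' x' /\ modally_equivalent y y'.
Proof.
(* Persistence carries the theory of [y] up to [x], and equivalence carries it on to [x']. *)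
move=> Hle' e le_yx; apply: preimage_compact_theory => // f yf.
by apply/e; exact: sat_mle yf.
Qed.

Lemma modally_equivalent_S_forth P (M M' : model P) (x y : M) (x' : M') :
  strictly_condensed M' -> preimage_compact (@mle P M') ->
  image_compact (@mS P M') -> modally_equivalent x x' -> mS x y ->
  exists y', mS x' y' /\ modally_equivalent y y'.
Proof.
move=> HM' Hle' HS' e Sxy.
have [z' [Sx'z' sub]] := image_compact_theory HS' e Sxy.
have [y' [le_y'z' e']] := preimage_compact_theory Hle' sub.
(* Strict condensation is applied to the chain [x' >= x' S' z' >= y']. *)
exists y'; split=> //; apply: HM'; exists z'; split=> //.
by exists x'; split=> //; exact: mle_refl.
Qed.

Theorem theorem5p14 (P : Type) (M M' : model P)
  (HM : strictly_condensed M) (HM' : strictly_condensed M')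
  (Hle : preimage_compact (@mle P M)) (Hle' : preimage_compact (@mle P M'))
  (HS : image_compact (@mS P M)) (HS' : image_compact (@mS P M')) :
  forall (x : world M) (x' : world M'),
    bisimilar x x' <-> (forall phi : formula P, sat x phi <-> sat x' phi).
Proof.
move=> x x'; split=> [[B [bB Bxx']]|e].
  exact: bisimulation_modally_equivalent bB _ _ Bxx'.
exists (@modally_equivalent P M M'); split=> // {x x' e}.
split=> x x' e.
- by move=> p; exact: (e (FVar p)).
- by move=> y; exact: modally_equivalent_le_forth.
- move=> y' le_y'x'.
  have [y [le_yx e']] :=
    modally_equivalent_le_forth Hle (modally_equivalent_sym e) le_y'x'.
  by exists y; split=> //; exact: modally_equivalent_sym.
- by move=> y; exact: modally_equivalent_S_forth.
- move=> y' Sx'y'.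
  have [y [Sxy e']] :=
    modally_equivalent_S_forth HM Hle HS (modally_equivalent_sym e) Sx'y'.
  by exists y; split=> //; exact: modally_equivalent_sym.
Qed.
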